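(* Let $(X,\leq)$ be a partially ordered set and let $d$ be a metric on $X$ such that $(X,d)$ is a complete metric space. Let $F:X\times X\to X$ be a mapping having the mixed monotone property, and suppose there is a constant $k\in[0,1)$ such that for all $x,y,u,v\in X$ with $x\geq u$ and $y\leq v$, $$d(F(x,y),F(u,v))+d(F(y,x),F(v,u))\leq k\,[d(x,u)+d(y,v)].$$ Suppose there exist $x_0,y_0\in X$ such that either $$x_0\leq F(x_0,y_0)\ \text{ and }\ y_0\geq F(y_0,x_0),$$ or $$x_0\geq F(x_0,y_0)\ \text{ and }\ y_0\leq F(y_0,x_0).$$ Suppose moreover that for all $Y,\overline{Y}\in X\times X$ there exists $Z\in X\times X$ that is comparable to both $Y$ and $\overline{Y}$. Then the coupled fixed point of $F$ is unique, i.e. any two coupled fixed points of $F$ coincide.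
   Context: A mapping $F:X\times X\to X$ on a partially ordered set $(X,\leq)$ has the mixed monotone property if $F(x,y)$ is nondecreasing in $x$ and nonincreasing in $y$: for all $x_1,x_2,y\in X$, $x_1\leq x_2$ implies $F(x_1,y)\leq F(x_2,y)$, and for all $x,y_1,y_2\in X$, $y_1\leq y_2$ implies $F(x,y_1)\geq F(x,y_2)$. The product $X\times X$ carries the partial order $(u,v)\leq(x,y)\Leftrightarrow x\geq u$ and $y\leq v$; two elements $Y,Z$ of $X\times X$ are comparable if $Y\leq Z$ or $Z\leq Y$ in this order. A pair $(x,y)\in X\times X$ is a coupled fixed point of $F$ if $F(x,y)=x$ and $F(y,x)=y$. *)

(* Defs.v *)
From HB Require Import structures.
From mathcomp Require Import all_boot all_order all_algebra.
From mathcomp Require Import all_classical all_reals topology.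

Set Implicit Arguments.
Unset Strict Implicit.
Unset Printing Implicit Defensive.

Import Order.TTheory GRing.Theory Num.Theory.

Local Open Scope order_scope.

(* No compatibility between the order and the metric is required.  [Complete]
   also carries a distinguished point, i.e. the space is nonempty. *)
#[short(type="completeMetricPOrderType")]
HB.structure Definition CompleteMetricPOrder (disp : Order.disp_t)
    (R : realType) :=
  { X of Order.POrder disp X & Metric R X & Complete X }.

Section MixedMonotone.
Context {disp : Order.disp_t} {X : porderType disp}.

Definition mixed_monotone (F : X * X -> X) : Prop :=
  (forall x1 x2 y : X, x1 <= x2 -> F (x1, y) <= F (x2, y)) /\
  (forall x y1 y2 : X, y1 <= y2 -> F (x, y1) >= F (x, y2)).

Definition coupled_fixed_point (F : X * X -> X) (x y : X) : Prop :=
  F (x, y) = x /\ F (y, x) = y.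

End MixedMonotone.

(* The componentwise order on X * X, with the order of the second factor
   reversed ([X^d] is [X] with the dual order). *)
Notation mixed_prod X := (X *p X^d)%type.

Lemma le_mixed_prodE (disp : Order.disp_t) (X : porderType disp)
    (u v x y : X) :
  ((u, v) : mixed_prod X) <= ((x, y) : mixed_prod X) =
  (x >= u) && (y <= v).
Proof. by []. Qed.

(* Main.v *)
(* Coupled fixed points of F are the fixed points of T (x, y) = (F (x, y), F (y, x)),
   which is monotone for the mixed order and contracts the l1 distance between
   comparable pairs by the factor k. An orbit of T that starts at Z comparable
   to both fixed points Y and Y' stays comparable to them and approaches both
   at rate k ^ n, so Y = Y'. *)
Require Import Defs.
From HB Require Import structures.
From mathcomp Require Import all_boot all_order all_algebra.
From mathcomp Require Import all_classical all_reals topology.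
From mathcomp Require Import normed_module sequences.

Set Implicit Arguments.
Unset Strict Implicit.
Unset Printing Implicit Defensive.

Import Order.TTheory GRing.Theory Num.Theory.

Local Open Scope order_scope.

(** The right-hand side is a geometric sequence with ratio of absolute value below 1, so it tends to
    0, and a constant lower bound passes to the limit. No sign condition on [c] is involved. *)
Lemma le0_geometric_bound (R : realType) (a c k : R) :
  (0 <= k < 1)%R -> (forall n, a <= c * k ^+ n)%R -> (a <= 0)%R.
Proof.
move=> /andP[k0 k1] ac.
have /cvg_geometric ck : (`|k| < 1)%R by rewrite ger0_norm.
apply: (cvgr_to_ge (ck c)).
by apply: nearW => n; exact: ac.
Qed.

Section CoupledMap.
Context {disp : Order.disp_t} {R : realType}.
Context {X : completeMetricPOrderType disp R}.
Implicit Types (F : X * X -> X) (k : R) (p q r : mixed_prod X).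

Definition coupled_map F p : mixed_prod X := (F (p.1, p.2), F (p.2, p.1)).

(** The sum of the coordinate distances, rather than their maximum, is the quantity that the
    contraction hypothesis controls. *)
Definition l1_dist p q : R := (mdist (p.1 : X) q.1 + mdist (p.2 : X) q.2)%R.

Lemma l1_dist_sym p q : l1_dist p q = l1_dist q p.
Proof. by rewrite /l1_dist metric_sym [X in (_ + X)%R]metric_sym. Qed.

Lemma l1_dist_triangle q p r : (l1_dist p r <= l1_dist p q + l1_dist q r)%R.
Proof. by rewrite /l1_dist addrACA lerD// metric_triangle. Qed.

Lemma l1_dist_le0 p q : (l1_dist p q <= 0)%R -> p = q.
Proof.
case: p q => [x y] [u v]; rewrite /l1_dist /= => d0.
have : (mdist x u + mdist y v == 0)%R by rewrite eq_le d0 addr_ge0 ?mdist_ge0.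
rewrite paddr_eq0 ?mdist_ge0// => /andP[/eqP xu /eqP yv].
by rewrite (mdist_positivity _ _ xu) (mdist_positivity _ _ yv).
Qed.

Lemma coupled_map_fixed F (x y : X) :
  coupled_fixed_point F x y -> coupled_map F (x, y) = (x, y).
Proof. by rewrite /coupled_map => -[/= -> ->]. Qed.

Lemma coupled_map_le F p q :
  mixed_monotone F -> p <= q -> coupled_map F p <= coupled_map F q.
Proof.
case: p q => [u v] [x y] [Fl Fr]; rewrite !le_mixed_prodE => /andP[ux yv].
apply/andP; split => /=.
  (* [F (u, v) <= F (x, v) <= F (x, y)]: one coordinate moves at a time. *)
  exact: le_trans (Fl _ _ _ ux) (Fr _ _ _ yv).
(* Dually, [F (y, x) <= F (v, x) <= F (v, u)]. *)
exact: le_trans (Fl _ _ _ yv) (Fr _ _ _ ux).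
Qed.

Lemma coupled_map_comparable F p q :
  mixed_monotone F -> p >=< q -> coupled_map F p >=< coupled_map F q.
Proof.
by move=> Fm /orP[] /(coupled_map_le Fm) le_pq; apply/orP; [left|right].
Qed.

Section Contraction.
Context {F : X * X -> X} {k : R}.
Context (F_mixed : mixed_monotone F).
Context (F_contr : forall x y u v : X, x >= u -> y <= v ->
  (mdist (F (x, y)) (F (u, v)) + mdist (F (y, x)) (F (v, u))
     <= k * (mdist x u + mdist y v))%R).

(** The hypothesis on [F] treats only pairs with [q <= p]; the symmetry of [l1_dist] gives the other
    case. *)
Lemma coupled_map_contr p q : p >=< q ->
  (l1_dist (coupled_map F p) (coupled_map F q) <= k * l1_dist p q)%R.
Proof.
have contr_ge p' q' : q' <= p' ->
    (l1_dist (coupled_map F p') (coupled_map F q') <= k * l1_dist p' q')%R.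
  case: p' q' => [x y] [u v]; rewrite le_mixed_prodE => /andP[].
  exact: F_contr.
case/orP => [le_pq|/contr_ge//].
by rewrite l1_dist_sym [X in (_ <= _ * X)%R]l1_dist_sym contr_ge.
Qed.

Lemma coupled_map_iter_dist n p q : (0 <= k)%R ->
  p >=< q -> coupled_map F q = q ->
  (l1_dist (iter n (coupled_map F) p) q <= l1_dist p q * k ^+ n)%R.
Proof.
move=> k0 pq fix_q.
(* Since [q] is its own image, applying the map to both sides keeps each iterate comparable to [q],
   so the contraction applies at every step. *)
have cmp m : iter m (coupled_map F) p >=< q.
  by elim: m => // m IH /=; rewrite -fix_q coupled_map_comparable.
elim: n => [|n IH]; first by rewrite expr0 mulr1.
rewrite /= -{1}fix_q (le_trans (coupled_map_contr (cmp n)))//.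
by rewrite exprS mulrCA ler_wpM2l.
Qed.

Lemma coupled_map_fixed_unique p q r : (0 <= k < 1)%R ->
  r >=< p -> r >=< q -> coupled_map F p = p -> coupled_map F q = q -> p = q.
Proof.
move=> k01 rp rq fix_p fix_q; have /andP[k0 _] := k01.
apply: l1_dist_le0.
(* The constant adds the initial distances from [r] to the two fixed points: the triangle inequality
   through the [n]-th iterate of [r] leaves two terms, each shrunk by [k ^+ n]. *)
apply: (le0_geometric_bound (c := (l1_dist r p + l1_dist r q)%R) k01) => n.
apply: le_trans (l1_dist_triangle (iter n (coupled_map F) r) _ _) _.
by rewrite l1_dist_sym mulrDl lerD// coupled_map_iter_dist.
Qed.

End Contraction.
End CoupledMap.

Theorem theorem4 (disp : Order.disp_t) (R : realType)
    (X : completeMetricPOrderType disp R) (F : X * X -> X) (k : R)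
    (F_mixed : mixed_monotone F)
    (k_range : (0 <= k < 1)%R)
    (F_contr : forall x y u v : X, x >= u -> y <= v ->
      (mdist (F (x, y)) (F (u, v)) + mdist (F (y, x)) (F (v, u))
         <= k * (mdist x u + mdist y v))%R)
    (F_start : exists x0 y0 : X,
      (x0 <= F (x0, y0) /\ y0 >= F (y0, x0)) \/
      (x0 >= F (x0, y0) /\ y0 <= F (y0, x0)))
    (X_comparable : forall Y Y' : mixed_prod X, exists Z : mixed_prod X,
      Z >=< Y /\ Z >=< Y') :
  forall x y x' y' : X,
    coupled_fixed_point F x y -> coupled_fixed_point F x' y' ->
    (x, y) = (x', y').
Proof.
move=> x y x' y' /coupled_map_fixed fix_xy /coupled_map_fixed fix_xy'.
have [Z [ZY ZY']] := X_comparable (x, y) (x', y').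
exact (coupled_map_fixed_unique F_mixed F_contr k_range ZY ZY' fix_xy fix_xy').
Qed.
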